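(* For every integer $n\ge 0$, the group $G(B^{(n)})$ defined by the Bellaterra type automaton $B^{(n)}$ is the free product of $2n+1$ groups of order $2$.
   Context: An automaton is a quadruple $(Q,X,\phi,\psi)$ with nonempty sets $Q$ (internal states) and $X$ (finite alphabet), a state transition function $\phi:Q\times X\to Q$ and an output function $\psi:Q\times X\to X$. Let $X^*$ be the set of finite words over $X$ (including the empty word). For an automaton $Y=(Q,X,\phi,\psi)$ and $q\in Q$, the transformation $Y_q:X^*\to X^*$ is defined recursively by $Y_q(\varnothing)=\varnothing$ and $Y_q(xw)=\psi(q,x)\,Y_{\phi(q,x)}(w)$ for $x\in X$, $w\in X^*$. $Y$ is invertible if all $Y_q$, $q\in Q$, are bijective; then $G(Y)$, the group defined by $Y$, is the group of transformations of $X^*$ generated (under composition) by $Y_q$, $q\in Q$. Bellaterra type automata: for $n\ge1$, $B^{(n)}=(Q_n,\{0,1\},\phi_n,\widehat\psi_n)$, where $Q_1=\{a_1,b_1,c_1\}$ and $Q_n=\{a_n,b_n,c_n,q_{n1},\dots,q_{n,2n-2}\}$ for $n\ge2$ (a set of $2n+1$ elements). With $q_{n0}:=c_n$ and $q_{n,2n-1}:=a_n$: $\phi_n(a_n,0)=\phi_n(b_n,1)=c_n$, $\phi_n(a_n,1)=\phi_n(b_n,0)=b_n$, and $\phi_n(q_{ni},0)=\phi_n(q_{ni},1)=q_{n,i+1}$ for $0\le i\le 2n-2$. For $x\in\{0,1\}$: $\widehat\psi_n(q,x)=x$ if $q\in\{a_n,b_n\}$, and $\widehat\psi_n(q,x)=1-x$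 if $q\in Q_n\setminus\{a_n,b_n\}$. Further, $B^{(0)}$ is the one-state automaton over $\{0,1\}$ with state set $Q_0=\{c_0\}$, transitions $c_0\mapsto c_0$ for both letters, and output function interchanging $0$ and $1$. These automata are invertible. *)

(* Defs.v *)
From HB Require Import structures.
From mathcomp Require Import all_boot all_order all_fingroup.
From mathcomp Require Import all_classical.

Set Implicit Arguments.
Unset Strict Implicit.
Unset Printing Implicit Defensive.

Local Open Scope classical_set_scope.

Record bij (T : Type) := Bij { bij_fun :> T -> T; bijP : bijective bij_fun }.

Section BijGroup.
Variable T : Type.

Lemma bij_eq (f g : bij T) : f =1 g -> f = g.
Proof.
case: f g => [f fP] [g gP] /= /funext fg; subst g.
by congr Bij; exact: Prop_irrelevance.
Qed.

Definition bij_id : bij T := Bij (@Bijective _ _ id id (fun=> erefl) (fun=> erefl)).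

Definition bij_mul (f g : bij T) : bij T :=
  Bij (bij_comp (bijP f) (bijP g)).

Lemma bij_inv_subproof (f : bij T) : exists g : bij T, cancel f g /\ cancel g f.
Proof. by case: f => f [g fK gK]; exists (Bij (Bijective gK fK)). Qed.

Definition bij_inv (f : bij T) : bij T := projT1 (cid (bij_inv_subproof f)).

Lemma bij_invP (f : bij T) : cancel f (bij_inv f) /\ cancel (bij_inv f) f.
Proof. exact: (projT2 (cid (bij_inv_subproof f))). Qed.

Lemma bij_mulA : associative bij_mul.
Proof. by move=> f g h; apply: bij_eq. Qed.

Lemma bij_mul1f : left_id bij_id bij_mul.
Proof. by move=> f; apply: bij_eq. Qed.

Lemma bij_mulf1 : right_id bij_id bij_mul.
Proof. by move=> f; apply: bij_eq. Qed.

Lemma bij_mulVf : left_inverse bij_id bij_inv bij_mul.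
Proof. by move=> f; apply: bij_eq => x /=; exact: (bij_invP f).1. Qed.

Lemma bij_mulfV : right_inverse bij_id bij_inv bij_mul.
Proof. by move=> f; apply: bij_eq => x /=; exact: (bij_invP f).2. Qed.

HB.instance Definition _ := gen_eqMixin (bij T).
HB.instance Definition _ := gen_choiceMixin (bij T).
HB.instance Definition _ := isGroup.Build (bij T)
  bij_mulA bij_mul1f bij_mulf1 bij_mulVf bij_mulfV.

End BijGroup.

Section GeneratedSubgroup.
Variables (G : groupType) (S : set G).

Definition gen_set : set G :=
  smallest [set A : set G | group_closed (mem A)] S.

Definition gen_pred : {pred G} := mem gen_set.

Lemma gen_group_closed : group_closed gen_pred.
Proof.
split; first by rewrite inE => A [[A1 _] _]; have := A1; rewrite inE.
move=> x y; rewrite !inE => xS yS A [Agrp SA].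
have Ax := xS A (conj Agrp SA); have Ay := yS A (conj Agrp SA).
by have := Agrp.2 x y; rewrite !inE; apply.
Qed.

Record gen_group := Gen { gen_val :> G; gen_valP : gen_val \in gen_pred }.

HB.instance Definition _ := [isSub for gen_val].
HB.instance Definition _ := [Choice of gen_group by <:].
HB.instance Definition _ :=
  SubChoice_isSubGroup.Build G gen_pred gen_group gen_group_closed.

End GeneratedSubgroup.

(* [G] is the coproduct of the family [H] in the category of groups; the      *)
(* embeddings [iota i] are then automatically injective.                     *)
Definition is_free_product (I : Type) (H : I -> groupType) (G : groupType) :
    Prop :=
  exists iota : forall i, {multiplicative H i -> G},
  forall (K : groupType) (f : forall i, {multiplicative H i -> K}),
    (exists g : {multiplicative G -> K}, forall i x, g (iota i x) = f i x) /\
    (forall g g' : {multiplicative G -> K},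
       (forall i x, g (iota i x) = f i x) ->
       (forall i x, g' (iota i x) = f i x) -> g =1 g').

Record automaton := Automaton {
  state : Type;
  letter : finType;
  trans : state -> letter -> state;
  output : state -> letter -> letter;
  state_nonempty : inhabited state;
  letter_nonempty : inhabited letter }.

Fixpoint transformation (Y : automaton) (q : state Y) (w : seq (letter Y)) :
    seq (letter Y) :=
  if w is x :: w' then output q x :: transformation (trans q x) w' else [::].

Definition invertible (Y : automaton) : Prop :=
  forall q : state Y, bijective (transformation q).

Definition automaton_group (Y : automaton) (Yinv : invertible Y) : groupType :=
  gen_group (range (fun q : state Y => Bij (Yinv q))).

(* In the alphabet [bool], [false] is the letter 0 and [true] the letter 1.   *)
(* [Bq i], with i counted from 0, is the state q_{n,i+1}. Only meant for      *)
(* n >= 1; there are 2n + 1 states.                                          *)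
Inductive bstate (n : nat) : Type :=
  Ba | Bb | Bc | Bq of 'I_(2 * n - 2).

Arguments Ba {n}.
Arguments Bb {n}.
Arguments Bc {n}.

(* q_{n,i} for 0 <= i <= 2n - 1, with q_{n,0} = c_n and q_{n,2n-1} = a_n.      *)
Definition bq (n i : nat) : bstate n :=
  if i is j.+1 then (if insub j is Some k then Bq k else Ba) else Bc.

Definition btrans (n : nat) (q : bstate n) (x : bool) : bstate n :=
  match q with
  | Ba => if x then Bb else Bc
  | Bb => if x then Bc else Bb
  | Bc => bq n 1
  | Bq i => bq n i.+2
  end.

Definition boutput (n : nat) (q : bstate n) (x : bool) : bool :=
  match q with
  | Ba | Bb => x
  | Bc | Bq _ => ~~ x
  end.

Lemma bq_last (n : nat) : 0 < n -> bq n (2 * n - 1) = Ba.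
Proof.
case: n => // n _; rewrite /bq.
have -> : (2 * n.+1 - 1 = (2 * n.+1 - 2).+1)%N by rewrite -subSn ?subSS // leq_pmulr.
by case: insubP => //= k; rewrite ltnn.
Qed.

Lemma btrans_bq (n i : nat) (x : bool) :
  i <= 2 * n - 2 -> btrans (bq n i) x = bq n i.+1.
Proof.
by case: i => [//|i lt_i]; rewrite {1}/bq insubT.
Qed.

Definition bellaterra_pos (n : nat) : automaton :=
  @Automaton (bstate n) bool (@btrans n) (@boutput n)
    (inhabits Ba) (inhabits false).

Definition bellaterra0 : automaton :=
  @Automaton unit bool (fun q _ => q) (fun _ x => ~~ x)
    (inhabits tt) (inhabits false).

Definition bellaterra (n : nat) : automaton :=
  if n is 0 then bellaterra0 else bellaterra_pos n.

Lemma involutive_output_invertible (Y : automaton) :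
  (forall q : state Y, involutive (output q)) -> invertible Y.
Proof.
move=> outK q.
pose inv := fix inv (q : state Y) (w : seq (letter Y)) :=
  if w is y :: w' then output q y :: inv (trans q (output q y)) w' else [::].
by exists (inv q) => w; elim: w q => [|x w IHw] q //=; rewrite outK IHw.
Qed.

Lemma bellaterra_invertible (n : nat) : invertible (bellaterra n).
Proof.
apply: involutive_output_invertible.
by case: n => [|n] q x /=; [exact: negbK | case: q => //= *; exact: negbK].
Qed.

Arguments bellaterra_invertible : clear implicits.

(* Main.v *)
(* Let w = q_1 ... q_k be a word over the states with no two equal neighbours
   ("reduced"). If q_1, ..., q_k compose to the identity, then so do all words
   obtained from w by the dual automaton, whose states are the letters 0, 1
   and which acts invertibly on reduced words of each length. A word with an
   odd number of states that change their letter is visibly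
   nontrivial, so it suffices that the dual automaton is transitive on reduced
   words of length k, which is shown by induction on k. The two dual
   transformations differ by the letterwise transposition (b c). Applying this
   transposition and the dual letter 0 to alternating words
   q_i q_{i+1} q_i q_{i+1} ... shows that all extensions of the alternating
   word in q_{n,2n-2}, a_n by one letter are in one orbit, except perhaps the
   alternating one. If the latter were alone in its orbit, some power r > 0 of
   the dual letter 0 would fix the infinite alternating word, but the r-th
   iterate of its prefix of length 2^(r+1) has an odd number of
   letter-changing states, whereas the prefix itself has 2^r of them. *)

From HB Require Import structures.
Require Import Defs.
From mathcomp Require Import all_boot all_fingroup zmodp zify.
From mathcomp Require Import boolp classical_sets.

Set Implicit Arguments.
Unset Strict Implicit.
Unset Printing Implicit Defensive.

(** [f] permutes the finitely many words of the length of [w]. *)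
Lemma iter_cancel_of_size (L : finType) (f : seq L -> seq L) (w : seq L) :
  injective f -> (forall u, size (f u) = size u) ->
  exists2 r, 0 < r & iter r f w = w.
Proof.
move=> f_inj size_f.
pose g (t : (size w).-tuple L) : (size w).-tuple L :=
  Tuple (introT eqP (etrans (size_f t) (size_tuple t))).
have g_inj : injective g by move=> t t' /(congr1 val)/f_inj/val_inj.
have iter_g r t : val (iter r g t) = iter r f (val t).
  by elim: r => //= r ->.
exists (fingraph.order g (in_tuple w)); first exact: fingraph.order_gt0.
by rewrite -(iter_g _ (in_tuple w)) iter_order.
Qed.

Local Ltac ifs := repeat (case: ifP => ?); try lia.

(** * The dual automaton *)

Section DualAction.
Variable M : nat.

(* With [M = 2n - 2], the states c, q_1, ..., q_{2n-2}, a, b are encoded by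
   0, 1, ..., M, M+1, M+2. *)

Notation letter := 'I_M.+3.
Notation word := (seq letter).
Implicit Types (x : bool) (z : seq bool) (p q : letter) (u v w : word).

(** Transition on the letter 0: a cycle through c, q_1, ..., q_M, a that fixes b. Exchanging b and c
    afterwards gives the transition on 1. *)
Definition cyc p : letter :=
  inord (if p == M.+2 :> nat then M.+2
         else if p == M.+1 :> nat then 0 else p.+1).

Definition swp p : letter :=
  inord (if p == 0 :> nat then M.+2 else if p == M.+2 :> nat then 0 else p).

Definition flips p := p <= M.

Definition step x p := if x then swp (cyc p) else cyc p.

Lemma val_cyc p :
  cyc p = (if p == M.+2 :> nat then M.+2
           else if p == M.+1 :> nat then 0 else p.+1)
  :> nat.
Proof. by rewrite inordK //; have := ltn_ord p; ifs. Qed.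

Lemma val_swp p :
  swp p = (if p == 0 :> nat then M.+2 else if p == M.+2 :> nat then 0 else p)
  :> nat.
Proof. by rewrite inordK //; have := ltn_ord p; ifs. Qed.

Lemma cyc_inj : injective cyc.
Proof.
move=> p q /(congr1 val); rewrite /= !val_cyc => pq; apply: val_inj => /=.
by move: pq; have := ltn_ord p; have := ltn_ord q; ifs.
Qed.

Lemma swpK : involutive swp.
Proof.
move=> p; apply: val_inj; rewrite /= val_swp; have := val_swp p.
by have := ltn_ord p; ifs.
Qed.

Lemma step_inj x : injective (step x).
Proof. by case: x => p q; [move/(can_inj swpK)|]; apply: cyc_inj. Qed.

Lemma val_step_flips x p : flips p -> step x p = p.+1 :> nat.
Proof.
rewrite /flips => ple.
have cycE : cyc p = p.+1 :> nat by rewrite val_cyc; ifs.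
by case: x; rewrite /step ?val_swp cycE //; ifs.
Qed.

Lemma step_flips x p : step (x (+) flips p) p = step x p.
Proof.
have [flip_p|] := boolP (flips p); last by rewrite addbF.
by apply: val_inj; rewrite /= !val_step_flips.
Qed.

Lemma stepN x p : step (~~ x) p = swp (step x p).
Proof. by case: x; rewrite //= swpK. Qed.

(* [dual x (q_1 ... q_k)] lists the states reached from [q_1], ..., [q_k] when
   the letter [x] runs through them in turn. *)
Fixpoint dual x w : word :=
  if w is q :: w' then step x q :: dual (x (+) flips q) w' else [::].

Definition parity w := odd (count flips w).

Lemma parity_cons q w : parity (q :: w) = flips q (+) parity w.
Proof. by rewrite /parity /= oddD oddb. Qed.

Lemma parity_cat u v : parity (u ++ v) = parity u (+) parity v.
Proof. by rewrite /parity count_cat oddD. Qed.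

Lemma size_dual x w : size (dual x w) = size w.
Proof. by elim: w x => //= q w IHw x; rewrite IHw. Qed.

Lemma dual_inj x : injective (dual x).
Proof.
move=> u; elim: u x => [|p u IHu] x [|q v] //= [/step_inj <-].
by move/IHu->.
Qed.

Lemma dual_cat x u v : dual x (u ++ v) = dual x u ++ dual (x (+) parity u) v.
Proof.
elim: u x => [|q u IHu] x; first by rewrite addbF.
by rewrite /= IHu parity_cons addbA.
Qed.

Lemma dualN x w : dual (~~ x) w = map swp (dual x w).
Proof. by elim: w x => //= q w IHw x; rewrite addNb IHw stepN. Qed.

Definition reduced w := sorted (fun p q => p != q) w.

(** By [step_flips], two neighbours are moved by one and the same injective [step]. *)
Lemma reduced_dual x w : reduced (dual x w) = reduced w.
Proof.
case: w => //= p w; rewrite /reduced /=.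
elim: w p x => //= q w IHw p x; rewrite IHw; congr (_ && _).
by rewrite -(step_flips x p) (inj_eq (@step_inj _)).
Qed.

(** * Orbits of words under the dual automaton *)

Definition duals z w := foldl (fun u x => dual x u) w z.

Lemma duals_cat z1 z2 w : duals (z1 ++ z2) w = duals z2 (duals z1 w).
Proof. exact: foldl_cat. Qed.

Lemma size_duals z w : size (duals z w) = size w.
Proof. by elim: z w => //= x z IHz w; rewrite IHz size_dual. Qed.

Lemma reduced_duals z w : reduced (duals z w) = reduced w.
Proof. by elim: z w => //= x z IHz w; rewrite IHz reduced_dual. Qed.

Lemma duals_section z u :
  exists z', forall v, duals z (u ++ v) = duals z u ++ duals z' v.
Proof.
elim: z u => [|x z IHz] u; first by exists [::].
have [z' zz'] := IHz (dual x u).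
by exists ((x (+) parity u) :: z') => v; rewrite /= dual_cat zz'.
Qed.

Lemma duals_rcons z u q :
  exists q', duals z (rcons u q) = rcons (duals z u) q'.
Proof.
have [z' zz'] := duals_section z u.
have := size_duals z' [:: q]; case def_q: (duals z' [:: q]) => [|q' []] // _.
by exists q'; rewrite -cats1 zz' def_q cats1.
Qed.

Lemma duals_prefix z u v : duals z (u ++ v) = u ++ v -> duals z u = u.
Proof.
have [z' ->] := duals_section z u.
by move/eqP; rewrite eqseq_cat ?size_duals // => /andP[/eqP].
Qed.

Lemma duals_nseq x r w : duals (nseq r x) w = iter r (dual x) w.
Proof. by elim: r w => // r IHr w; rewrite iterSr -IHr. Qed.

Definition conn u v := exists z, duals z u = v.

Lemma conn_refl u : conn u u.
Proof. by exists [::]. Qed.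

Lemma conn_trans v u w : conn u v -> conn v w -> conn u w.
Proof. by move=> [z1 <-] [z2 <-]; exists (z1 ++ z2); rewrite duals_cat. Qed.

Lemma conn_dual x u : conn u (dual x u).
Proof. by exists [:: x]. Qed.

Lemma dual_conn x u : conn (dual x u) u.
Proof.
have [[|r] // _ rK] := iter_cancel_of_size u (@dual_inj x) (size_dual x).
by exists (nseq r x); rewrite duals_nseq -iterSr.
Qed.

Lemma conn_sym u v : conn u v -> conn v u.
Proof.
move=> [z <-]; elim: z u => [|x z IHz] u; first exact: conn_refl.
exact: conn_trans (IHz _) (dual_conn x u).
Qed.

Lemma conn_dual2 x u v : conn u v -> conn (dual x u) (dual x v).
Proof.
move=> uv; apply: conn_trans (conn_dual x v).
exact: conn_trans (dual_conn x u) uv.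
Qed.

(** [u] is the image under [dual false] of one of its iterates; by [dualN], [dual true] takes that
    iterate to [map swp u]. *)
Lemma conn_swp u : conn u (map swp u).
Proof.
have [[|r] // _ rK] :=
  iter_cancel_of_size u (@dual_inj false) (size_dual false).
rewrite -{2}rK iterS -dualN -duals_nseq.
by apply: conn_trans (conn_dual _ _); exists (nseq r false).
Qed.

Lemma reduced_conn u v : conn u v -> reduced u = reduced v.
Proof. by move=> [z <-]; rewrite reduced_duals. Qed.

(** * Alternating words *)

Fixpoint alternating p q k : word :=
  if k is k'.+1 then p :: alternating q p k' else [::].

Lemma size_alternating p q k : size (alternating p q k) = k.
Proof. by elim: k p q => //= k IHk p q; rewrite IHk. Qed.

Lemma alternatingSr p q k :
  alternating p q k.+1 = rcons (alternating p q k) (if odd k then q else p).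
Proof.
elim: k p q => // k IHk p q.
by rewrite [LHS]/= -/(alternating q p k.+1) IHk /=; case: (odd k).
Qed.

Lemma alternating_prefix p q j k :
  exists v, alternating p q (k + j) = alternating p q j ++ v.
Proof.
elim: j p q => [|j IHj] p q; first by exists (alternating p q (k + 0)).
by have [v ev] := IHj q p; exists v; rewrite addnS /= ev.
Qed.

Lemma alternating_double p q k :
  alternating p q k.*2 = flatten (nseq k [:: p; q]).
Proof. by elim: k => //= k ->. Qed.

Lemma dual_alternating x p q k : flips p -> flips q ->
  dual x (alternating p q k) = alternating (cyc p) (cyc q) k.
Proof.
elim: k x p q => //= k IHk x p q fp fq; rewrite IHk //; congr (_ :: _).
by apply: val_inj; rewrite /= val_step_flips // -(val_step_flips false fp).
Qed.

Lemma map_swp_alternating p q k : 0 < p < M.+2 -> 0 < q < M.+2 ->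
  map swp (alternating p q k) = alternating p q k.
Proof.
elim: k p q => //= k IHk p q pP qP; rewrite IHk //; congr (_ :: _).
by apply: val_inj; rewrite /= val_swp; ifs.
Qed.

Let b : letter := ord_max.

(* Induction on [i]: [dual false] carries the alternating word in i - 1, i to
   the one in i, i + 1 and shifts the last letter up by one, and [swp] fixes
   the latter word while it links the last letters b and c. *)
Lemma conn_alternating_children (i k : nat) p q (r : letter) : i <= M ->
  (p = i :> nat /\ q = i.+1 :> nat) \/ (p = i.+1 :> nat /\ q = i :> nat) ->
  r < i ->
  conn (rcons (alternating p q k) b) (rcons (alternating p q k) r).
Proof.
elim: i p q r => // i IHi p q r ltiM pqi ltri.
have swp_pq : map swp (alternating p q k) = alternating p q k.
  by apply: map_swp_alternating; lia.
have conn_b0 (s : letter) : (s = 0 :> nat) \/ (s = b) ->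
    conn (rcons (alternating p q k) b) (rcons (alternating p q k) s).
  case=> [s0|->]; last exact: conn_refl.
  have := conn_swp (rcons (alternating p q k) b).
  rewrite map_rcons swp_pq; congr (conn _ (rcons _ _)).
  by apply: val_inj; rewrite /= val_swp /= s0 eqxx.
have [r0|r_gt0] := posnP r; first by apply: conn_b0; left.
pose p' : letter := inord p.-1; pose q' : letter := inord q.-1.
pose r' : letter := inord r.-1.
have val_p' : p' = p.-1 :> nat by rewrite inordK //; have := ltn_ord p; lia.
have val_q' : q' = q.-1 :> nat by rewrite inordK //; have := ltn_ord q; lia.
have val_r' : r' = r.-1 :> nat by rewrite inordK //; have := ltn_ord r; lia.
have flips_p' : flips p' by rewrite /flips; lia.
have flips_q' : flips q' by rewrite /flips; lia.
have flips_r' : flips r' by rewrite /flips; lia.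
have cyc_p' : cyc p' = p.
  by apply: val_inj; rewrite /= val_cyc; have := ltn_ord p; ifs.
have cyc_q' : cyc q' = q.
  by apply: val_inj; rewrite /= val_cyc; have := ltn_ord q; ifs.
have /(conn_dual2 false) :
    conn (rcons (alternating p' q' k) b) (rcons (alternating p' q' k) r').
  by apply: IHi; lia.
rewrite -!cats1 !dual_cat !dual_alternating //= cyc_p' cyc_q' !cats1.
set x := parity _.
have -> : step x r' = r by apply: val_inj; rewrite /= val_step_flips //; lia.
apply: conn_trans; apply: conn_b0.
have cyc_b : cyc b = b by apply: val_inj; rewrite /= val_cyc /= eqxx.
by case: x; rewrite /step cyc_b; [left; rewrite val_swp /= eqxx | right].
Qed.

(** * Parity under the dual transformations *)

(** The two successors of a letter-changing state coincide, whereas those of a or b are b and c, of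
    which only c changes letters. *)
Lemma flips_step_pair x p :
  flips (step x p) (+) flips (step (~~ x) p) = ~~ flips p.
Proof.
rewrite stepN; have := val_swp (step x p); have := ltn_ord p.
have [fp|] := boolP (flips p).
  by rewrite /flips val_step_flips //; move: fp; rewrite /flips; ifs.
rewrite /flips /step; have := val_cyc p; case: x; last by ifs.
by have := val_swp (cyc p); ifs.
Qed.

Lemma parity_dual_pair x w :
  parity (dual x w) (+) parity (dual (~~ x) w) = parity w (+) odd (size w).
Proof.
elim: w x => //= p w IHw x.
rewrite !parity_cons addNb addbACA IHw flips_step_pair.
by case: flips (parity w) (odd _) => [] [] [].
Qed.

(* If [w] has even length and odd parity, then so has the section
   [dual false w ++ dual true w] of [w ++ w]. *)
Lemma parity_iter_dual t w : ~~ odd (size w) -> parity w ->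
  parity (iter t (dual false) (flatten (nseq (2 ^ t) w))).
Proof.
elim: t w => [|t IHt] w size_w odd_w; first by rewrite /= cats0.
have dual_pow j : dual false (flatten (nseq j.*2 w))
    = flatten (nseq j (dual false w ++ dual true w)).
  elim: j => // j IHj; rewrite doubleS /= catA dual_cat dual_cat odd_w.
  by rewrite parity_cat odd_w IHj.
rewrite iterSr expnS mul2n dual_pow; apply: IHt.
  by rewrite size_cat !size_dual addnn odd_double.
by rewrite parity_cat (parity_dual_pair false) odd_w (negPf size_w).
Qed.

(** * Transitivity on reduced words *)

Definition transitive_at k := forall u v,
  size u = k -> size v = k -> reduced u -> reduced v -> conn u v.

Lemma transitive_at1 : transitive_at 1.
Proof.
have conn0 i p : p = i :> nat -> i <= M.+1 -> conn [:: ord0] [:: p].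
  elim: i p => [|i IHi] p pi lti.
    by rewrite (_ : p = ord0); [apply: conn_refl | apply: val_inj].
  pose p' : letter := inord i.
  have val_p' : p' = i :> nat by rewrite inordK //; lia.
  apply: conn_trans (IHi p' val_p' (ltnW lti)) _; exists [:: false] => /=.
  by congr [:: _]; apply: val_inj; rewrite /= val_cyc; ifs.
have {}conn0 p : conn [:: ord0] [:: p].
  have [/(conn0 p p erefl)//|ltp] := leqP p M.+1.
  apply: conn_trans (conn_swp _) _; exists [::] => /=; congr [:: _].
  by apply: val_inj; rewrite /= val_swp /=; have := ltn_ord p; lia.
move=> [|p []] // [|q []] // _ _ _ _.
exact: conn_trans (conn_sym (conn0 p)) (conn0 q).
Qed.

(** Transitivity at length k moves the first k letters of any reduced word onto [u], so only the
    last letter is left to adjust. *)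
Lemma transitive_rcons k u c : transitive_at k -> size u = k -> reduced u ->
  (forall r, reduced (rcons u r) -> conn (rcons u c) (rcons u r)) ->
  transitive_at k.+1.
Proof.
move=> trans_k size_u red_u conn_u.
suff conn_c w : size w = k.+1 -> reduced w -> conn (rcons u c) w.
  move=> v w size_v size_w red_v red_w.
  exact: conn_trans (conn_sym (conn_c v _ _)) (conn_c w _ _).
case/lastP: w => // w q; rewrite size_rcons => -[size_w] red_wq.
have red_w : reduced w by move: red_wq; rewrite -cats1 => /cat_sorted2[].
have [z zw] := trans_k w u size_w size_u red_w red_u.
have [r zwq] := duals_rcons z w q.
have wq_ur : conn (rcons w q) (rcons u r) by exists z; rewrite zwq zw.
apply: conn_trans (conn_u r _) (conn_sym wq_ur).
by rewrite -(reduced_conn wq_ur).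
Qed.

(** The states q_{n,2n-2} and a_n in either order, as dropping the first letter of an alternating
    word exchanges them. *)
Definition top_pair p q :=
  (p = M :> nat /\ q = M.+1 :> nat) \/ (p = M.+1 :> nat /\ q = M :> nat).

Lemma top_pairC p q : top_pair p q -> top_pair q p.
Proof. by case=> -[? ?]; [right | left]. Qed.

Lemma reduced_alternating p q k : p != q -> reduced (alternating p q k).
Proof.
case: k => //= k; elim: k p q => //= k IHk p q pq.
by rewrite pq IHk // eq_sym.
Qed.

Lemma top_pair_neq p q : top_pair p q -> p != q.
Proof. by move=> pq; rewrite -val_eqE /=; move: pq; rewrite /top_pair; lia. Qed.

(** A last letter below M is linked to b. Of the letters M and M+1, one repeats the end of the word
    and the other continues the alternation. *)
Lemma alternating_child p q k r : 0 < k -> top_pair p q ->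
  reduced (rcons (alternating p q k) r) ->
  rcons (alternating p q k) r = alternating p q k.+1 \/
  conn (rcons (alternating p q k) b) (rcons (alternating p q k) r).
Proof.
case: k => // k _ pq red_r.
have [->|r_b] := eqVneq r b; first by right; apply: conn_refl.
have [r_lt|r_ge] := ltnP r M.
  by right; apply: (@conn_alternating_children M).
left; rewrite [RHS]alternatingSr; congr rcons; apply: val_inj.
move: red_r; rewrite alternatingSr -!cats1 -catA /= /reduced sorted_cat_cons.
case/andP=> _; rewrite /= andbT -val_eqE /=.
move: r_b; rewrite -val_eqE /=; move: pq (ltn_ord r); rewrite /top_pair.
by case: (odd k) => /=; lia.
Qed.

(* Self-similarity: the section at the first letter of an element fixing an
   alternating word of length k + 1 fixes the alternating word of length k
   that starts with the other letter. *)
Lemma duals_alternating k : 0 < k ->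
  (forall p q z, top_pair p q ->
     duals z (alternating p q k) = alternating p q k ->
     duals z (alternating p q k.+1) = alternating p q k.+1) ->
  forall j p q z, top_pair p q ->
  duals z (alternating p q k) = alternating p q k ->
  duals z (alternating p q (j + k)) = alternating p q (j + k).
Proof.
move=> k_gt0 fix_next; elim=> // j IHj p q z pq fix_k.
have [z' zz'] := duals_section z [:: p].
have fix_p : duals z [:: p] = [:: p].
  case: k k_gt0 fix_k {fix_next IHj} => //= k _.
  have := zz' (alternating q p k); rewrite /= => ->.
  have := size_duals z [:: p].
  by case: (duals z [:: p]) => [|p' []] //= _ [->].
have duals_p v : duals z (p :: v) = p :: duals z' v by rewrite (zz' v) fix_p.
rewrite addSn /= duals_p IHj //; first exact: top_pairC.
by have := fix_next p q z pq fix_k; rewrite /= duals_p => -[].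
Qed.

Lemma transitive_atS k : 0 < k -> transitive_at k -> transitive_at k.+1.
Proof.
move=> k_gt0 trans_k.
have [[p [q [pq conn_b]]]|isolated] := EM (exists p q, top_pair p q /\
    conn (rcons (alternating p q k) b) (alternating p q k.+1)).
  apply: (@transitive_rcons k (alternating p q k) b) => //.
  - exact: size_alternating.
  - exact/reduced_alternating/top_pair_neq.
  - by move=> r /(alternating_child k_gt0 pq)[->|].
(* By [isolated], no other one-letter extension lies in the orbit of the alternating one. *)
have fix_next p q z : top_pair p q ->
    duals z (alternating p q k) = alternating p q k ->
    duals z (alternating p q k.+1) = alternating p q k.+1.
  move=> pq fix_k.
  have [r zr] := duals_rcons z (alternating p q k) (if odd k then q else p).
  rewrite -alternatingSr fix_k in zr.
  have := reduced_duals z (alternating p q k.+1).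
  rewrite zr reduced_alternating ?top_pair_neq // => red_r.
  have [//|conn_b] := alternating_child k_gt0 pq red_r.
  case: isolated; exists p, q; split=> //; apply: conn_trans conn_b _.
  by apply: conn_sym; exists z.
pose d : letter := inord M; pose a : letter := inord M.+1.
have val_d : d = M :> nat by rewrite inordK //; lia.
have val_a : a = M.+1 :> nat by rewrite inordK.
have da : top_pair d a by left.
(* This power of [dual false] fixes the word of length k, hence by [fix_next] all longer alternating
   words in d, a. *)
have [r r_gt0 rK] :=
  iter_cancel_of_size (alternating d a k) (@dual_inj false) (size_dual false).
have fix_pow : iter r (dual false) (flatten (nseq (2 ^ r) [:: d; a]))
    = flatten (nseq (2 ^ r) [:: d; a]).
  rewrite -alternating_double -duals_nseq.
  have [v def_v] := alternating_prefix d a (2 ^ r).*2 k.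
  apply: (@duals_prefix _ _ v); rewrite -def_v addnC.
  by apply: (duals_alternating k_gt0 fix_next) => //; rewrite duals_nseq.
have flips_d : flips d by rewrite /flips val_d.
have flips_a : flips a = false by rewrite /flips val_a ltnn.
(* The block d, a has even length and one letter-changing state, so the iterate has odd parity; yet
   it consists of 2^r such blocks, an even number. *)
have := @parity_iter_dual r [:: d; a] erefl.
rewrite /parity /= flips_d flips_a => /(_ erefl); rewrite fix_pow.
suff -> n : count flips (flatten (nseq n [:: d; a])) = n.
  by rewrite oddX => /orP[/eqP r0|//]; rewrite r0 in r_gt0.
by elim: n => //= n ->; rewrite flips_d flips_a.
Qed.

Lemma transitive_at_pos k : 0 < k -> transitive_at k.
Proof.
case: k => // k _; elim: k => [|k IHk]; first exact: transitive_at1.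
exact: transitive_atS.
Qed.

(** * Action of state words on binary words *)

Fixpoint trf q z : seq bool :=
  if z is x :: z' then (x (+) flips q) :: trf (step x q) z' else [::].

Lemma trfK p : involutive (trf p).
Proof.
by move=> z; elim: z p => //= x z IHz p; rewrite step_flips IHz addbK.
Qed.

Definition act w z := foldl (fun z' q => trf q z') z w.

Lemma act_cons w x z : act w (x :: z) = (x (+) parity w) :: act (dual x w) z.
Proof.
elim: w x z => [|q w IHw] x z /=; first by rewrite addbF.
by rewrite -/(act w _) IHw parity_cons addbA.
Qed.

Definition acts_trivially w := forall z, act w z = z.

Lemma acts_trivially_parity w : acts_trivially w -> parity w = false.
Proof. by move/(_ [:: false]); rewrite act_cons => -[]. Qed.

(** Sections of a trivial transformation are trivial, and each dual step passes to a section. *)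
Lemma acts_trivially_conn u v :
  conn u v -> acts_trivially u -> acts_trivially v.
Proof.
move=> [z <-]; elim: z u => //= x z IHz u triv_u; apply: IHz => y.
by have := triv_u (x :: y); rewrite act_cons => -[].
Qed.

Lemma reduced_acts_nontrivially w :
  reduced w -> w <> [::] -> ~ acts_trivially w.
Proof.
case: w => // q w red_w _ triv_w; set k := size w.
pose a : letter := inord M.+1.
have val_a : a = M.+1 :> nat by rewrite inordK.
have flips_a : flips a = false by rewrite /flips val_a ltnn.
have flips_b : flips b = false by rewrite /flips /=; lia.
have ab : a != b by rewrite -val_eqE /= val_a; lia.
(* The state c followed by a, b, a, ... is a reduced word of the same length with exactly one
   letter-changing state. *)
pose v := ord0 :: alternating a b k.
have red_v : reduced v.
  have : reduced (alternating a b k) by apply: reduced_alternating.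
  rewrite /v; case: k {v} => //= k; rewrite /reduced /= => ->.
  by rewrite andbT -val_eqE /= val_a.
have parity_v : parity v.
  rewrite parity_cons {1}/flips /=.
  suff /(_ a b flips_a flips_b)-> : forall c d, flips c = false ->
    flips d = false -> parity (alternating c d k) = false by [].
  by elim: k {v red_v} => //= k IHk c d fc fd; rewrite parity_cons fc IHk.
have /acts_trivially_conn/(_ triv_w)/acts_trivially_parity : conn (q :: w) v.
  by apply: (@transitive_at_pos k.+1); rewrite //= size_alternating.
by rewrite parity_v.
Qed.

End DualAction.
(** * Free products of groups of order two *)

Section Involutions.
Local Open Scope group_scope.

Lemma multiplicative1 (H K : groupType) (f : {multiplicative H -> K}) : f 1 = 1.
Proof. by apply: (mulgI (f 1)); rewrite -gmulfM !mulg1. Qed.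

Definition word_prod (I : Type) (G : groupType) (g : I -> G) (w : seq I) : G :=
  foldr (fun i x => g i * x) 1 w.

Lemma word_prod_cat (I : Type) (G : groupType) (g : I -> G) u v :
  word_prod g (u ++ v) = word_prod g u * word_prod g v.
Proof. by elim: u => [|i u /= ->]; rewrite ?mul1g ?mulgA. Qed.

Lemma word_prod_rev (I : Type) (G : groupType) (g : I -> G) w :
  (forall i, g i * g i = 1) -> word_prod g (rev w) = (word_prod g w)^-1.
Proof.
move=> gg1; elim: w => [|i w IHw]; first by rewrite invg1.
rewrite rev_cons -cats1 word_prod_cat IHw /= mulg1 invgM; congr (_ * _).
by apply: (mulgI (g i)); rewrite gg1 mulgV.
Qed.

(** The [1] compared with [x] is the neutral element of ['Z_2], that is, the residue 0. *)
Definition involution_hom (G : groupType) (g : G) (x : 'Z_2) : G :=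
  if x == 1 then 1 else g.

Lemma involution_homM (G : groupType) (g : G) : g * g = 1 ->
  {morph involution_hom g : x y / x * y}.
Proof.
move=> gg1.
move=> [[|[|//]] ?] [[|[|//]] ?];
  by rewrite /involution_hom /= ?mul1g ?mulg1 ?gg1.
Qed.

Variables (I : eqType) (G : groupType) (g : I -> G).
Hypothesis gg1 : forall i, g i * g i = 1.
Hypothesis generated : forall x, exists w, word_prod g w = x.
Hypothesis reduced_neq1 : forall w,
  sorted (fun i j => i != j) w -> w <> [::] -> word_prod g w <> 1.

Lemma adjacent_equal (w : seq I) : ~~ sorted (fun i j => i != j) w ->
  exists u i v, w = u ++ [:: i, i & v].
Proof.
case: w => //= i w; elim: w i => //= j w IHw i.
rewrite negb_and negbK => /orP[/eqP->|/IHw[u [k [v ->]]]].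
  by exists [::], j, w.
by exists (i :: u), k, v.
Qed.

(** A nonempty word with product 1 is not reduced, and cancelling two equal neighbours alters
    neither product. *)
Lemma word_prod_relation (K : groupType) (f : I -> K) w :
  (forall i, f i * f i = 1) -> word_prod g w = 1 -> word_prod f w = 1.
Proof.
move=> ff1; have [n] := ubnP (size w); elim: n w => // n IHn w size_w gw1.
case: w => // j w in size_w gw1 *.
have [red_w|] := boolP (sorted (fun i j => i != j) (j :: w)).
  by case: (reduced_neq1 red_w).
case/adjacent_equal=> u [i [v def_w]]; rewrite def_w in size_w gw1 *.
move: gw1; rewrite !word_prod_cat /= (mulgA (g i)) gg1 (mulgA (f i)) ff1.
rewrite !mul1g -!word_prod_cat.
by apply: IHn; move: size_w; rewrite !size_cat /=; lia.
Qed.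

Lemma free_product_of_involutions :
  is_free_product (fun _ : I => 'Z_2 : groupType) G.
Proof.
pose iota i : {multiplicative 'Z_2 -> G} := HB.pack (involution_hom (g i))
  (isMultiplicative.Build 'Z_2 G _ (involution_homM (gg1 i))).
exists iota.
move=> K f; pose o : 'Z_2 := Zp1; pose h i := f i o.
have oo : o * o = 1 by apply: val_inj.
have hh1 i : h i * h i = 1 by rewrite -gmulfM oo multiplicative1.
have fE i x : f i x = if x == 1 then 1 else h i.
  case: x => [[|[|//]] ?]; rewrite /=.
    by rewrite -[RHS](multiplicative1 (f i)); congr (f i _); apply: val_inj.
  by congr (f i _); apply: val_inj.
split; last first.
  move=> k k' kf k'f x; have [w <-] := generated x.
  elim: w => [|i w IHw] /=; first by rewrite !multiplicative1.
  by rewrite !gmulfM IHw -[g i]/(iota i o) kf k'f.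
pose decomp x := projT1 (cid (generated x)).
have decompK x : word_prod g (decomp x) = x.
  exact: projT2 (cid (generated x)).
pose k x := word_prod h (decomp x).
(* If two words have equal products under [g], the first followed by the reverse of the second is a
   relation, which [h] satisfies too. So the choice in [decomp] does not matter. *)
have kE w : k (word_prod g w) = word_prod h w.
  apply: divg1_eq; rewrite -word_prod_rev // -word_prod_cat.
  apply: word_prod_relation => //.
  by rewrite word_prod_cat word_prod_rev // decompK mulgV.
have kM : {morph k : x y / x * y}.
  move=> x y; rewrite -[x in LHS]decompK -[y in LHS]decompK.
  by rewrite -word_prod_cat kE word_prod_cat.
pose kk : {multiplicative G -> K} :=
  HB.pack k (isMultiplicative.Build G K k kM).
exists kk => i x; rewrite -[kk _]/(k (involution_hom (g i) x)).
rewrite fE /involution_hom; case: eqP => _.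
  exact: (kE [::]).
by have := kE [:: i]; rewrite /= !mulg1.
Qed.

End Involutions.

(** Reversing a word of involutions inverts its product, so the products form a subgroup. *)
Lemma gen_group_word_prod (T : Type) (I : Type) (S : set (bij T))
    (g : I -> gen_group S) :
  (forall i, g i * g i = 1)%g ->
  (forall f, S f -> exists i, gen_val (g i) = f) ->
  forall x, exists w, word_prod g w = x.
Proof.
move=> gg1 gS x; have := gen_valP x; rewrite inE => /(_ (fun f =>
  exists w, gen_val (word_prod g w) = f)) [].
  split; last by move=> f /gS[i <-]; exists [:: i]; rewrite /= mulg1.
  split; first by rewrite inE; exists [::].
  move=> f h; rewrite !inE => -[u <-] [v <-].
  by exists (u ++ rev v); rewrite word_prod_cat word_prod_rev.
by move=> w /val_inj <-; exists w.
Qed.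

(** Given involutivity, the last condition for words of length two makes [q] injective, so [I]
    numbers the states. *)
Lemma automaton_group_free_product (Y : automaton) (Yinv : invertible Y)
    (I : eqType) (q : I -> state Y) :
  (forall s, exists i, q i = s) ->
  (forall i, involutive (transformation (q i))) ->
  (forall w, sorted (fun i j => i != j) w -> w <> [::] ->
    ~ (foldr (fun i => transformation (q i)) ^~ w =1 id)) ->
  is_free_product (fun _ : I => 'Z_2 : finGroupType) (automaton_group Yinv).
Proof.
move=> q_surj q_inv q_red.
have gP i : Bij (Yinv (q i)) \in gen_pred (range (fun s => Bij (Yinv s))).
  by rewrite inE => A [_]; apply; exists (q i).
pose g i : automaton_group Yinv := Gen (gP i).
have gg1 i : (g i * g i = 1)%g.
  by apply: val_inj; apply: Defs.bij_eq => z; apply: q_inv.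
have val_prod w z :
    gen_val (word_prod g w) z = foldr (fun i => transformation (q i)) z w.
  by elim: w => //= i w <-.
apply: (free_product_of_involutions gg1).
  apply: gen_group_word_prod => // f [s _ <-].
  by have [i <-] := q_surj s; exists i.
move=> w red_w w_n0 w1; apply: (q_red w red_w w_n0) => z.
by rewrite -val_prod w1.
Qed.

(** * The Bellaterra automata *)

Section Bellaterra.
Variable N : nat.
Let n := N.+1.

(** Here M is 2N = 2n - 2; the number 2N + 1 = 2n - 1 gives a_n through [bq]. *)
Definition bellaterra_state (p : 'I_(2 * N).+3) : bstate n :=
  if p == (2 * N).+2 :> nat then Bb else bq n p.

Lemma bellaterra_state_surj s : exists p, bellaterra_state p = s.
Proof.
case: s => [|||[i lti]].
- exists (inord (2 * n - 1)); rewrite /bellaterra_state inordK /n; last by lia.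
  by rewrite ifN ?bq_last //; lia.
- by exists ord_max; rewrite /bellaterra_state eqxx.
- by exists ord0.
- exists (inord i.+1); rewrite /bellaterra_state inordK; last first.
    by move: lti; rewrite /n; lia.
  rewrite ifN; last by move: lti; rewrite /n; lia.
  by rewrite /bq insubT; congr Bq; apply: val_inj.
Qed.

Lemma btrans_bellaterra_state p x :
  btrans (bellaterra_state p) x = bellaterra_state (step x p).
Proof.
have bqa : bq n (2 * N).+1 = Ba.
  by rewrite -(@bq_last n) //; congr bq; rewrite /n; lia.
have [fp|] := boolP (flips p).
  rewrite /bellaterra_state val_step_flips //; move: fp; rewrite /flips => fp.
  by rewrite !ifN ?btrans_bq //; rewrite /n; lia.
rewrite /flips => fp; have [pb|pb] := eqVneq (p : nat) (2 * N).+2.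
  have cb : cyc p = (2 * N).+2 :> nat by rewrite val_cyc pb eqxx.
  rewrite {1}/bellaterra_state pb eqxx.
  case: x; rewrite /step /bellaterra_state.
    by rewrite val_swp cb /= eqxx.
  by rewrite cb eqxx.
have pa : p = (2 * N).+1 :> nat by have := ltn_ord p; lia.
have ca : cyc p = 0 :> nat by rewrite val_cyc pa eqxx; ifs.
rewrite {1}/bellaterra_state ifN // pa bqa.
by case: x; rewrite /step /bellaterra_state ?val_swp ca //= eqxx.
Qed.

Lemma boutput_bellaterra_state p x :
  boutput (bellaterra_state p) x = x (+) flips p.
Proof.
have bqa : bq n (2 * N).+1 = Ba.
  by rewrite -(@bq_last n) //; congr bq; rewrite /n; lia.
rewrite /bellaterra_state /flips; case: eqP => [->|pb].
  by rewrite ltnNge leqW // addbF.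
have [ple|ple] := leqP p (2 * N).
  case: p pb ple => [[|i] lti] //= _ ple; rewrite addbT //.
  by rewrite insubT //; rewrite /n; lia.
have -> : p = (2 * N).+1 :> nat by have := ltn_ord p; lia.
by rewrite bqa addbF.
Qed.

Lemma transformation_bellaterra_state p z :
  @transformation (bellaterra_pos n) (bellaterra_state p) z = trf p z.
Proof.
elim: z p => //= x z IHz p.
by rewrite boutput_bellaterra_state btrans_bellaterra_state IHz.
Qed.

Lemma bellaterra_pos_free_product :
  is_free_product (fun _ : 'I_(2 * N).+3 => 'Z_2 : finGroupType)
    (automaton_group (bellaterra_invertible n)).
Proof.
apply: (@automaton_group_free_product (bellaterra n) _ _ bellaterra_state).
- exact: bellaterra_state_surj.
- by move=> p z; rewrite !transformation_bellaterra_state trfK.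
move=> w red_w w_n0 w1.
(* Composition applies the last state first and [act] the first, hence the reversal. *)
apply: (@reduced_acts_nontrivially _ (rev w)).
- rewrite /reduced rev_sorted (eq_sorted (e' := fun p q => p != q)) // => p q.
  by rewrite eq_sym.
- by move/(congr1 rev); rewrite revK.
move=> z; rewrite /act foldl_rev -[RHS]w1.
elim: w {red_w w_n0 w1} => //= p w <-.
by rewrite transformation_bellaterra_state.
Qed.

End Bellaterra.

Lemma transformation_bellaterra0 (q : unit) (z : seq bool) :
  @transformation bellaterra0 q z = map negb z.
Proof. by elim: z q => //= x z IHz q; rewrite IHz. Qed.

Lemma bellaterra0_free_product :
  is_free_product (fun _ : 'I_1 => 'Z_2 : finGroupType)
    (automaton_group (bellaterra_invertible 0)).
Proof.
apply: (@automaton_group_free_product (bellaterra 0) _ 'I_1 (fun=> tt)).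
- by case; exists ord0.
- by move=> _ z; rewrite !transformation_bellaterra0 mapK //; apply: negbK.
move=> [|i [|j w]] // red_w _; last by move: red_w; rewrite (ord1 i) (ord1 j).
by move/(_ [:: true]).
Qed.

Theorem theorem1p5 (n : nat) :
  exists H : 'I_(2 * n + 1) -> finGroupType,
    (forall i, #|H i| = 2) /\
    is_free_product H (automaton_group (bellaterra_invertible n)).
Proof.
exists (fun=> 'Z_2 : finGroupType); split; first by move=> _; rewrite card_ord.
case: n => [|n]; first exact: bellaterra0_free_product.
rewrite addn1 mulnS; exact: bellaterra_pos_free_product.
Qed.
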